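(* Consider the semidiscrete scheme for displacement boundary conditions $u_J = g_J$ on $\partial\Omega$, $$\rho\,\ddot{\mathbf u}_J = \mathbb D^{\Omega}_{IK}(C_{IJKL})\,\mathbf u_L + (\mathcal J H)^{-1}\sum_{f\in\mathcal F}\left(\mathbb T_{LJ}-\mathbb Z_{LJ}\right)^T e_f\,\hat J\,H_f\left(e_f^T\mathbf u_L-\boldsymbol g_L\right),\qquad J=1,\dots,d,$$ with $$\mathbb Z_{JL} = \beta\,\frac{d\,\hat J}{h_1\,\mathcal J}\,n_I\,C_{IJKL}\,n_K .$$ If $\beta\ge 1$, then the scheme is stable, in the following sense: for homogeneous data $\boldsymbol g_J=0$ every solution satisfies $\frac{d}{dt}E_d=0$, where $$E_d=\tfrac12(\dot{\mathbf u}_J,\rho\,\dot{\mathbf u}_J)_\Omega+\tfrac12(D_I\mathbf u_J,C_{IJKL}D_K\mathbf u_L)_\Omega+\tfrac12\mathbf u_J^T\mathbb W_{JL}\mathbf u_L-(\mathbf u_J,\mathbb T_{JL}\mathbf u_L)_{\partial\Omega}+\tfrac12(\mathbf u_J,\mathbb Z_{JL}\mathbf u_L)_{\partial\Omega},$$ and $E_d\ge 0$ for all $\mathbf u_J,\dot{\mathbf u}_J$.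
   Context: Conventions. Repeated subscripts $i,j,k,\ell,I,J,K,L$ are summed from $1$ to $d$, also inside bilinear forms, except where ''no sum'' is stated. Boldface symbols are real grid vectors. A spatially variable coefficient is identified with the diagonal matrix of its grid values. The physical domain $\Omega\subset\mathbb R^d$ is the image of the reference cube $\omega=[0,1]^d$ (coordinates $x_i$) under a smooth one-to-one map $X_I=X_I(x_1,\dots,x_d)$. One-dimensional operators. On a grid of $[0,1]$ including both end points, $H_x=\mathrm{diag}(h_1,h_2,\dots,h_2,h_1)$ has positive diagonal entries (proportional to the grid spacing $h$); $e_0=(1,0,\dots,0)^T$, $e_N=(0,\dots,0,1)^T$. The first-derivative summation-by-parts (SBP) operator $D_x\approx\partial_x$ satisfies $H_xD_x=-D_x^TH_x-e_0e_0^T+e_Ne_N^T$. The fully compatible second-derivative SBP operator $D^{FC}_{xx}(b)\approx\partial_x b\,\partial_x$ satisfies $$H_xD^{FC}_{xx}(b)=-D_x^TH_xbD_x-R_{xx}(b)-e_0e_0^TbD_x+e_Ne_N^TbD_x,$$ where $R_{xx}(b)=\sum_\alpha\mathcal D_{x^\alpha}^TB_\alpha(b)\mathcal D_{x^\alpha}$, the matrices $\mathcal D_{x^\alpha}$ do not depend on $b$, and $B_\alpha(b)$ is diagonal with entries $(B_\alpha(b))_r=\sum_s\beta_{\alpha,r,s}b_s$, $\beta_{\alpha,r,s}\ge0$, $b_s$ being the value of $b$ at grid point $s$. The same grid spacing (hence the same $h_1$) is used in each coordinate direction. Multi-dimensional operators on $\omega$. $D_i=I\otimes\cdots\otimes D_{x_i}\otimes\cdots\otimes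 I$ (with $D_{x_i}$ in position $i$); $D^{FC}_{ii}(b)$ (no sum) applies $D^{FC}_{xx}(b)$ along each grid line in direction $i$; $\mathbb D_{ij}(b)=D^{FC}_{ii}(b)$ if $i=j$ and $\mathbb D_{ij}(b)=D_i\,b\,D_j$ if $i\ne j$. $H=H_{x_1}\otimes\cdots\otimes H_{x_d}$. The faces of $\omega$ are $\partial\omega_i^-=\{x_i=0\}$, $\partial\omega_i^+=\{x_i=1\}$; $\mathcal F$ is the set of all $2d$ faces. For $f=\partial\omega_i^\pm$, $e_f^T$ restricts a grid vector to the grid points of $f$, and $H_f=H_{x_1}\otimes\cdots\otimes H_{x_{i-1}}\otimes H_{x_{i+1}}\otimes\cdots\otimes H_{x_d}$. $R_{ii}(b)$ (no sum) is the matrix that applies $R_{xx}(b)$ along each grid line in direction $i$ and weights each grid line with the corresponding diagonal entry of $H_{\partial\omega_i^\pm}$. Metric quantities. $F_{Ii}$ are the grid values of (a possibly approximate) transformation gradient $\partial x_i/\partial X_I$, invertible at each grid point; $\mathcal J=\det[(F^{-1})_{iI}]>0$ is the Jacobian determinant (denoted $J$ in the literature; written $\mathcal J$ here to distinguish it from the index $J$); $\nu_i$ is the outward unit normal of $\omega$; $\hat J>0$ is the surface area scale factor; $n_I=\hat J^{-1}\mathcal JF_{Ii}\nu_i$ is the outward normal of $\Omega$. The quantities $\nu_i,n_I,\hat J$ are defined face by face: in any expression associated with the face $f$ they take the values belonging to $f$, also at edge and corner points. $D_I=F_{Ii}D_i$. Material. $\rho>0$ is the density. The real stiffness tensor satisfies,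 at each grid point, $C_{IJKL}=C_{KLIJ}$ and $S_{IJ}C_{IJKL}S_{KL}\ge0$ for all $S_{IJ}$. The transformed stiffness tensor is $c_{iJkL}=F_{Ii}\,\mathcal J\,C_{IJKL}F_{Kk}$. Define $$\mathbb D^\Omega_{IK}(C_{IJKL})=\mathcal J^{-1}\mathbb D_{ik}(c_{iJkL}),\qquad \mathbb W_{JL}=\sum_kR_{kk}(c_{kJkL}),\qquad \mathbb T_{JL}=n_IC_{IJKL}D_K$$ ($\mathbb T_{JL}$ is the discrete traction operator). Discrete integrals. $(\mathbf u,\mathbf v)_\Omega=\mathbf u^T\mathcal JH\mathbf v$ and $(\mathbf u,\mathbf v)_{\partial\Omega}=\sum_{f\in\mathcal F}(e_f^T\mathbf u)^T\hat JH_f(e_f^T\mathbf v)$, where face-dependent quantities in the arguments (such as $n_I$, $\mathbb T_{JL}$, $\mathbb Z_{JL}$) take their values for the face $f$ in the $f$-th summand. External body forces are set to zero, and $\boldsymbol g_L$ is the boundary data on each face. *)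

(* Defs.v *)
(* MathComp / MathComp-Analysis *)
From mathcomp Require Import all_boot all_order all_algebra.
From mathcomp Require Import all_classical all_reals all_analysis.
Set Implicit Arguments.
Unset Strict Implicit.
Unset Printing Implicit Defensive.
Import Order.TTheory GRing.Theory Num.Theory.
Import numFieldNormedType.Exports.
Local Open Scope ring_scope.

(* A grid of [0,1] has the points 0, ..., N. The sizes and the number of the
   matrices Dal a (a indexes alpha) are free. "Approximates the derivative" is
   not a precise condition and is not part of the structure: only the algebraic
   properties are. *)
Record sbp_ops (R : realType) (N : nat) (h1 : R) := SbpOps {
  hx : 'rV[R]_N.+1;
  hx_gt0 : forall r, 0 < hx 0 r;
  hx_first : hx 0 ord0 = h1;
  hx_rev : forall r, hx 0 (rev_ord r) = hx 0 r;
  Dx : 'M[R]_N.+1;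
  Dx_sbp :
    let Hx := diag_mx hx in
    let e0 : 'cV[R]_N.+1 := delta_mx ord0 0 in
    let eN : 'cV[R]_N.+1 := delta_mx ord_max 0 in
    Hx *m Dx = - (Dx^T *m Hx) - e0 *m e0^T + eN *m eN^T;
  nal : nat;
  nrow : 'I_nal -> nat;
  Dal : forall a : 'I_nal, 'M[R]_(nrow a, N.+1);
  betal : forall a : 'I_nal, 'M[R]_(nrow a, N.+1);
  betal_ge0 : forall a r s, 0 <= betal a r s;
  Bal := fun (a : 'I_nal) (b : 'rV[R]_N.+1) =>
    diag_mx (\row_(r < nrow a) \sum_s betal a r s * b 0 s);
  Rxx := fun b : 'rV[R]_N.+1 =>
    \sum_(a < nal) (Dal a)^T *m Bal a b *m Dal a;
  Dxx : 'rV[R]_N.+1 -> 'M[R]_N.+1;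
  Dxx_sbp : forall b : 'rV[R]_N.+1,
    let Hx := diag_mx hx in
    let e0 : 'cV[R]_N.+1 := delta_mx ord0 0 in
    let eN : 'cV[R]_N.+1 := delta_mx ord_max 0 in
    Hx *m Dxx b = - (Dx^T *m Hx *m diag_mx b *m Dx) - Rxx b
                  - e0 *m e0^T *m diag_mx b *m Dx
                  + eN *m eN^T *m diag_mx b *m Dx
}.

Section Grid.
Context (d N : nat).

Definition grid := {ffun 'I_d -> 'I_N.+1}.

(* (i, false) is the face x_i = 0 and (i, true) is the face x_i = 1. *)
Definition face := ('I_d * bool)%type.

Definition on_face (f : face) (p : grid) : bool :=
  p f.1 == (if f.2 then ord_max else ord0).

Definition face_pt (f : face) := {p : grid | on_face f p}.

Definition same_line (i : 'I_d) (p q : grid) : bool :=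
  [forall j, (j != i) ==> (p j == q j)].

Definition on_line (i : 'I_d) (p : grid) (s : 'I_N.+1) : grid :=
  [ffun j => if j == i then s else p j].

End Grid.

(* MathComp matrices have ordinal indices, so the components of a grid vector
   are numbered by the enumeration of the finite type of grid points. *)
Definition fmx (R : Type) (S T : finType) (A : S -> T -> R) :
    'M[R]_(#|S|, #|T|) :=
  \matrix_(k, l) A (enum_val k) (enum_val l).

Definition fdiag (R : realType) (T : finType) (b : T -> R) : 'M[R]_#|T| :=
  diag_mx (\row_k b (enum_val k)).

Section Elastic.
Context (R : realType) (d N : nat) (h1 : R).
Notation grid := (grid d N).
Notation face := (face d).
Notation gvec := ('cV[R]_#|grid|).
Notation gmx := ('M[R]_#|grid|).

Context (ops : 'I_d -> sbp_ops N h1).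

Definition Hx (i : 'I_d) : 'M[R]_N.+1 := diag_mx (hx (ops i)).

(* The entries of a Kronecker product are the products of the entries. *)
Definition kron (A : 'I_d -> 'M[R]_N.+1) : gmx :=
  fmx (fun p q : grid => \prod_j A j (p j) (q j)).

Definition Hgrid : gmx := kron Hx.

Definition D1 (i : 'I_d) : gmx :=
  kron (fun j => if j == i then Dx (ops j) else 1%:M).

Definition D2 (i : 'I_d) (b : grid -> R) : gmx :=
  fmx (fun p q : grid => if same_line i p q
    then Dxx (ops i) (\row_s b (on_line i p s)) (p i) (q i) else 0).

Definition DD (i k : 'I_d) (b : grid -> R) : gmx :=
  if i == k then D2 i b else D1 i *m fdiag b *m D1 k.

(* The weight is the diagonal entry of the face quadrature that belongs to the
   grid line through p in direction i. *)
Definition RR (i : 'I_d) (b : grid -> R) : gmx :=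
  fmx (fun p q : grid => if same_line i p q
    then (\prod_(j | j != i) Hx j (p j) (p j)) *
         Rxx (ops i) (\row_s b (on_line i p s)) (p i) (q i) else 0).

Definition eface (f : face) : 'M[R]_(#|grid|, #|{: face_pt N f}|) :=
  fmx (fun (p : grid) (q : face_pt N f) => (p == val q)%:R).

Definition Hface (f : face) : 'M[R]_#|{: face_pt N f}| :=
  fmx (fun p q : face_pt N f =>
    \prod_(j | j != f.1) Hx j (val p j) (val q j)).

(* F p I i is F_{Ii} at the grid point p. A function that belongs to a face f,
   such as hatJ f, is defined on the whole grid for convenience; only its values
   at the points of f matter, because the face restriction is always applied. *)
Context (F : grid -> 'M[R]_d) (hatJ : face -> grid -> R)
        (C : 'I_d -> 'I_d -> 'I_d -> 'I_d -> grid -> R).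

Definition Jac (p : grid) : R := \det (invmx (F p)).

Definition nu (f : face) (i : 'I_d) : R :=
  if i == f.1 then (if f.2 then 1 else -1) else 0.

Definition normal (f : face) (I : 'I_d) (p : grid) : R :=
  \sum_i (hatJ f p)^-1 * Jac p * F p I i * nu f i.

Definition DI (I : 'I_d) : gmx := \sum_i fdiag (fun p => F p I i) *m D1 i.

Definition cten (i J k L : 'I_d) (p : grid) : R :=
  \sum_I \sum_K F p I i * Jac p * C I J K L p * F p K k.

(* The sums over I, K are inside cten. *)
Definition DOmega (J L : 'I_d) : gmx :=
  fdiag (fun p => (Jac p)^-1) *m \sum_i \sum_k DD i k (cten i J k L).

Definition WW (J L : 'I_d) : gmx := \sum_k RR k (cten k J k L).

Definition TT (f : face) (J L : 'I_d) : gmx :=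
  \sum_I \sum_K fdiag (fun p => normal f I p * C I J K L p) *m DI K.

Definition ZZ (beta : R) (f : face) (J L : 'I_d) : gmx :=
  fdiag (fun p => \sum_I \sum_K
    beta * (d%:R * hatJ f p / (h1 * Jac p)) *
    normal f I p * C I J K L p * normal f K p).

Definition hatJface (f : face) : 'M[R]_#|{: face_pt N f}| :=
  fdiag (fun p : face_pt N f => hatJ f (val p)).

Definition ip_vol (u v : gvec) : R :=
  (u^T *m fdiag Jac *m Hgrid *m v) 0 0.

Definition ip_bnd (u v : face -> gvec) : R :=
  \sum_(f : face) (((eface f)^T *m u f)^T *m hatJface f *m Hface f *m
                   ((eface f)^T *m v f)) 0 0.

Context (rho : grid -> R) (beta : R).

Definition bnd_data := forall f : face, 'I_d -> 'cV[R]_#|{: face_pt N f}|.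

Definition rhs (g : bnd_data) (u : 'I_d -> gvec) (J : 'I_d) : gvec :=
  \sum_L DOmega J L *m u L +
  invmx (fdiag Jac *m Hgrid) *m
    \sum_(f : face) \sum_L
      (TT f L J - ZZ beta f L J)^T *m eface f *m hatJface f *m Hface f *m
      ((eface f)^T *m u L - g f L).

(* u is twice differentiable on the open set U of times, with velocity v. *)
Definition scheme_solution (U : set R) (g : R -> bnd_data)
    (u v : R -> 'I_d -> gvec) : Prop :=
  (forall t, U t -> forall J, is_derive t 1 (fun s => u s J) (v t J)) /\
  exists a : R -> 'I_d -> gvec,
    (forall t, U t -> forall J, is_derive t 1 (fun s => v s J) (a t J)) /\
    (forall t, U t -> forall J, fdiag rho *m a t J = rhs (g t) (u t) J).

Definition energy (u v : 'I_d -> gvec) : R :=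
  2^-1 * (\sum_J ip_vol (v J) (fdiag rho *m v J))
  + 2^-1 * (\sum_I \sum_J \sum_K \sum_L
      ip_vol (DI I *m u J) (fdiag (C I J K L) *m (DI K *m u L)))
  + 2^-1 * (\sum_J \sum_L ((u J)^T *m WW J L *m u L) 0 0)
  - (\sum_J \sum_L ip_bnd (fun _ => u J) (fun f => TT f J L *m u L))
  + 2^-1 * (\sum_J \sum_L ip_bnd (fun _ => u J) (fun f => ZZ beta f J L *m u L)).

End Elastic.

(* Main.v *)
(** Discrete Green's formula.  Applied along grid lines, the one-dimensional
    summation-by-parts rules give H D_i = - D_i^T H + B_i and a corresponding
    rule for the compatible second derivative, B_i being the diagonal face
    quadrature.  Hence the volume operator, weighted by Jac H, equals boundary
    traction minus elastic energy form minus W.  Every block matrix involved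
    except the traction is symmetric, and the penalty terms of the scheme supply
    exactly what is missing for the power balance to vanish.

    Positivity.  A grid point lies on at most d faces, so 1/d of the elastic
    energy at that point can be spent on each face containing it.  On a face the
    volume weight is h1 times the face weight; with x = d hatJ / (h1 Jac), n_I u_J
    written S and D_I u_J written G, the three terms on that face add up to a
    positive multiple of C(G - x S, G - x S) + (beta - 1) x^2 C(S, S). *)
Require Import Defs.
From mathcomp Require Import all_boot all_order all_algebra.
From mathcomp Require Import all_classical all_reals all_analysis.
From mathcomp Require Import ring lra.
Import Order.TTheory GRing.Theory Num.Theory.
Import numFieldNormedType.Exports.
Local Open Scope ring_scope.

Set Implicit Arguments.
Unset Strict Implicit.
Unset Printing Implicit Defensive.

(** * Matrices indexed by finite types; grid functions as diagonal matrices *)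

Lemma fmxE (R : Type) (S T : finType) (A : S -> T -> R) p q :
  fmx A (enum_rank p) (enum_rank q) = A p q.
Proof. by rewrite mxE !enum_rankK. Qed.

Lemma fmx_ext (R : Type) (S T : finType) (M M' : 'M[R]_(#|S|, #|T|)) :
  (forall p q, M (enum_rank p) (enum_rank q) = M' (enum_rank p) (enum_rank q)) ->
  M = M'.
Proof.
by move=> MM'; apply/matrixP => k l; rewrite -(enum_valK k) -(enum_valK l).
Qed.

Lemma sum_enum_rank (V : nmodType) (T : finType) (f : 'I_#|T| -> V) :
  \sum_k f k = \sum_(p : T) f (enum_rank p).
Proof. by rewrite (reindex (@enum_rank T)) //; apply/onW_bij/enum_rank_bij. Qed.

Section Fdiag.
Context (R : realType) (T : finType).
Implicit Types (a b : T -> R).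

Lemma fdiag_mull a n (M : 'M[R]_(#|T|, n)) p j :
  (fdiag a *m M) (enum_rank p) j = a p * M (enum_rank p) j.
Proof. by rewrite /fdiag mul_diag_mx !mxE enum_rankK. Qed.

Lemma fdiag_mulr a n (M : 'M[R]_(n, #|T|)) i q :
  (M *m fdiag a) i (enum_rank q) = M i (enum_rank q) * a q.
Proof. by rewrite /fdiag mul_mx_diag !mxE enum_rankK. Qed.

Lemma fdiagE a p q :
  fdiag a (enum_rank p) (enum_rank q) = if p == q then a p else 0.
Proof.
rewrite !mxE enum_rankK (inj_eq enum_rank_inj).
by case: eqP; rewrite ?mulr1n ?mulr0n.
Qed.

Lemma tr_fdiag a : (fdiag a)^T = fdiag a.
Proof. exact: tr_diag_mx. Qed.

Lemma fdiag1 : fdiag (fun=> 1) = 1%:M :> 'M[R]_#|T|.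
Proof.
by apply: fmx_ext => p q; rewrite fdiagE mxE (inj_eq enum_rank_inj); case: eqP.
Qed.

Lemma fdiagM a b : fdiag a *m fdiag b = fdiag (fun p => a p * b p).
Proof.
by apply: fmx_ext => p q; rewrite fdiag_mull !fdiagE; case: eqP; rewrite ?mulr0.
Qed.

Lemma fdiagC a b : fdiag a *m fdiag b = fdiag b *m fdiag a.
Proof. exact: diag_mxC. Qed.

Lemma fdiag_sum (I : Type) (r : seq I) (P : pred I) (a : I -> T -> R) :
  \sum_(i <- r | P i) fdiag (a i) = fdiag (fun p => \sum_(i <- r | P i) a i p).
Proof.
apply: fmx_ext => p q; rewrite summxE fdiagE.
under eq_bigr do rewrite fdiagE.
by case: eqP => // _; rewrite big1.
Qed.

Lemma eq_fdiag a b : a =1 b -> fdiag a = fdiag b.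
Proof. by move=> ab; apply: fmx_ext => p q; rewrite !fdiagE ab. Qed.

Lemma fdiag_unit a : (forall p, a p != 0) -> fdiag a \in unitmx.
Proof.
move=> a0; rewrite unitmxE det_diag unitfE prodf_seq_neq0.
by apply/allP => k _; rewrite mxE a0.
Qed.

Lemma dot_fdiag a (u v : 'cV[R]_#|T|) :
  (u^T *m fdiag a *m v) 0 0 =
  \sum_p a p * u (enum_rank p) 0 * v (enum_rank p) 0.
Proof.
rewrite mxE sum_enum_rank; apply: eq_bigr => p _.
by rewrite fdiag_mulr mxE [a p * _]mulrC.
Qed.

End Fdiag.

(** * One-dimensional summation by parts, entry by entry *)

Section SBP1.
Context (R : realType) (N : nat) (h1 : R) (o : sbp_ops N h1).

(** The diagonal of [eN *m eN^T - e0 *m e0^T]: both boundary terms of a summation-by-parts rule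
    become one signed weight. *)
Definition ends (r : 'I_N.+1) : R := (r == ord_max)%:R - (r == ord0)%:R.

Lemma Dx_sbpE r s : hx o 0 r * Dx o r s =
  - (hx o 0 s * Dx o s r) + (r == s)%:R * ends r.
Proof.
have /matrixP/(_ r s) := Dx_sbp o.
rewrite mul_diag_mx mul_mx_diag !mxE !big_ord1 !mxE !eqxx !andbT => ->.
rewrite /ends [Dx o s r * _]mulrC.
case: (r =P s) => [<-|/eqP rs].
  by rewrite -!natrM !mulnb !andbb mul1r; ring.
rewrite -!natrM !mulnb !mul0r.
(* Distinct indices cannot both equal the same end point, so the rank-one boundary terms vanish off
   the diagonal. *)
have rE x : (r == x) && (s == x) = false.
  by apply/negP => /andP[/eqP rx /eqP sx]; rewrite rx sx eqxx in rs.
by rewrite !rE; ring.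
Qed.

Lemma Dxx_sbpE b r s : hx o 0 r * Dxx o b r s =
  - (\sum_t Dx o t r * hx o 0 t * b 0 t * Dx o t s) - Rxx o b r s
  + ends r * b 0 r * Dx o r s.
Proof.
have /matrixP/(_ r s) := Dxx_sbp o b.
have e x : ((delta_mx x 0 : 'cV[R]_N.+1) *m (delta_mx x 0)^T *m diag_mx b *m Dx o)
   r s = (r == x)%:R * b 0 r * Dx o r s.
  have -> : (delta_mx x 0 : 'cV[R]_N.+1) *m (delta_mx x 0)^T = delta_mx x x.
    by rewrite trmx_delta mul_delta_mx.
  rewrite mul_mx_diag mxE (bigD1 x) //= big1 => [|k kx]; rewrite !mxE.
    by rewrite eqxx andbT addr0; case: eqP => [->//|]; rewrite !mul0r.
  by rewrite (negPf kx) andbF !mul0r.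
have dE : (((Dx o)^T *m diag_mx (hx o)) *m diag_mx b *m Dx o) r s =
    \sum_t Dx o t r * hx o 0 t * b 0 t * Dx o t s.
  by rewrite mxE; apply: eq_bigr => t _; rewrite !mul_mx_diag !mxE.
have addE (A B : 'M[R]_N.+1) : (A + B) r s = A r s + B r s by rewrite mxE.
have oppE (A : 'M[R]_N.+1) : (- A) r s = - A r s by rewrite mxE.
rewrite /= !addE !oppE !e dE [in LHS]mul_diag_mx [in LHS]mxE => ->.
rewrite /ends; ring.
Qed.

Lemma Rxx_sym b : (Rxx o b)^T = Rxx o b.
Proof.
rewrite /Rxx linear_sum; apply: eq_bigr => a _ /=.
by rewrite !trmx_mul trmxK tr_diag_mx mulmxA.
Qed.

End SBP1.

(** * Bilinear forms of block matrices and their time derivatives *)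

Section Bform.
Context (R : realType) (d n : nat).
Implicit Types (M : 'I_d -> 'I_d -> 'M[R]_n) (u v w : 'I_d -> 'cV[R]_n).

(** Every term of the energy is a value of such a form at equal arguments; two separate slots make
    the product rule and the exchange of arguments expressible. *)
Definition bform M u w : R := \sum_J \sum_L ((u J)^T *m M J L *m w L) 0 0.

Lemma eq_bform M M' u w : (forall J L, M J L = M' J L) -> bform M u w = bform M' u w.
Proof. by move=> MM'; apply: eq_bigr => J _; apply: eq_bigr => L _; rewrite MM'. Qed.

Lemma bformD M M' u w :
  bform (fun J L => M J L + M' J L) u w = bform M u w + bform M' u w.
Proof.
rewrite /bform -big_split /=; apply: eq_bigr => J _.
rewrite -big_split /=; apply: eq_bigr => L _.
by rewrite mulmxDr mulmxDl mxE.
Qed.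

Lemma bformN M u w : bform (fun J L => - M J L) u w = - bform M u w.
Proof.
rewrite /bform -sumrN; apply: eq_bigr => J _.
rewrite -sumrN; apply: eq_bigr => L _.
by rewrite mulmxN mulNmx mxE.
Qed.

(** Each summand is a 1 by 1 matrix, hence equal to its transpose. *)
Lemma bformC M u w : bform (fun J L => (M L J)^T) u w = bform M w u.
Proof.
rewrite /bform exchange_big /=; apply: eq_bigr => J _; apply: eq_bigr => L _.
transitivity (((w J)^T *m M J L *m u L)^T 0 0); last by rewrite mxE.
by rewrite !trmx_mul trmxK mulmxA.
Qed.

Lemma bform_sym M u w : (forall J L, (M L J)^T = M J L) -> bform M u w = bform M w u.
Proof. by move=> MC; rewrite -bformC; apply: eq_bform => J L; rewrite MC. Qed.

Lemma is_derive_mxentry m k (f : R -> 'M[R]_(m, k)) (t : R) (f' : 'M[R]_(m, k)) i j :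
  is_derive t 1 f f' -> is_derive t 1 (fun s => f s i j) (f' i j).
Proof.
move=> df; have [ft <-] := df.
rewrite derive_mx // mxE; apply: derivableP.
exact: (derivable_mxP _ _ _).1.
Qed.

Lemma is_derive_bigsum k (h : 'I_k -> R -> R) (t : R) (dh : 'I_k -> R) :
  (forall i, is_derive t 1 (h i) (dh i)) ->
  is_derive t 1 (fun s => \sum_i h i s) (\sum_i dh i).
Proof. by move=> dhh; have := is_derive_sum dhh; rewrite fct_sumE. Qed.

(** With all sums expanded, differentiation in time reduces to the product rule for scalar
    entries. *)
Lemma bformE M u w : bform M u w =
  \sum_J \sum_L \sum_k \sum_l M J L l k * (u J l 0 * w L k 0).
Proof.
apply: eq_bigr => J _; apply: eq_bigr => L _; rewrite mxE.
apply: eq_bigr => k _; rewrite mxE mulr_suml; apply: eq_bigr => l _.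
by rewrite mxE; ring.
Qed.

Lemma is_derive_bform M (u w : R -> 'I_d -> 'cV[R]_n) u' w' (t : R) :
  (forall J, is_derive t 1 (fun s => u s J) (u' J)) ->
  (forall J, is_derive t 1 (fun s => w s J) (w' J)) ->
  is_derive t 1 (fun s => bform M (u s) (w s))
    (bform M u' (w t) + bform M (u t) w').
Proof.
move=> du dw; under eq_fun do rewrite bformE.
rewrite !bformE -big_split /=; apply: is_derive_bigsum => J.
rewrite -big_split /=; apply: is_derive_bigsum => L.
rewrite -big_split /=; apply: is_derive_bigsum => k.
rewrite -big_split /=; apply: is_derive_bigsum => l.
apply: (@is_derive_eq _ _ _
  (M J L l k \*: ((fun s => u s J l 0) * (fun s => w s L k 0)))).
  apply: is_deriveZ; apply: is_deriveM; exact: is_derive_mxentry.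
by rewrite /GRing.scale /=; ring.
Qed.

End Bform.

(** [Bal a b] is linear in [b]. The form is therefore a combination, with weights
    [betal a r s >= 0], of the quadratic forms of [b] at the grid points [s], evaluated at the
    numbers [(Dal a *m U J) r 0]. Only the block coefficient has to be semidefinite, not each
    [b J L] nonnegative. *)
Lemma Rxx_psd (R : realType) (N : nat) (h1 : R) (o : sbp_ops N h1) (d : nat)
    (b : 'I_d -> 'I_d -> 'rV[R]_N.+1) (U : 'I_d -> 'cV[R]_N.+1) :
  (forall s (x : 'I_d -> R), 0 <= \sum_J \sum_L x J * b J L 0 s * x L) ->
  0 <= bform (fun J L => Rxx o (b J L)) U U.
Proof.
move=> b_psd.
rewrite (_ : bform _ U U = \sum_(a < nal o) \sum_r \sum_s betal a r s *
  \sum_J \sum_L (Dal a *m U J) r 0 * b J L 0 s * (Dal a *m U L) r 0).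
  by apply: sumr_ge0 => a _; apply: sumr_ge0 => r _; apply: sumr_ge0 => s _;
     rewrite mulr_ge0 ?betal_ge0.
transitivity (\sum_J \sum_L \sum_(a < nal o) \sum_r \sum_s betal a r s *
  ((Dal a *m U J) r 0 * b J L 0 s * (Dal a *m U L) r 0)); last first.
  under eq_bigr do rewrite exchange_big /=.
  rewrite exchange_big /=; apply: eq_bigr => a _.
  under eq_bigr do rewrite exchange_big /=.
  rewrite exchange_big /=; apply: eq_bigr => r _.
  under eq_bigr do rewrite exchange_big /=.
  rewrite exchange_big /=; apply: eq_bigr => s _.
  by rewrite mulr_sumr; apply: eq_bigr => J _; rewrite mulr_sumr.
apply: eq_bigr => J _; apply: eq_bigr => L _.
rewrite /Rxx mulmx_sumr mulmx_suml summxE; apply: eq_bigr => a _.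
rewrite !mulmxA -trmx_mul -mulmxA.
move: (Dal a *m U J) (Dal a *m U L) => x y.
rewrite mxE; apply: eq_bigr => r _.
rewrite /Bal mul_mx_diag !mxE mulr_sumr mulr_suml; apply: eq_bigr => s _.
by ring.
Qed.

(** * Summation by parts on the grid *)

Section Lines.
Context (d N : nat).
Implicit Types (p q : grid d N) (i : 'I_d).

Lemma same_lineP i p q :
  reflect (forall j, j != i -> p j = q j) (same_line i p q).
Proof.
apply: (iffP forallP) => pq j.
  by move=> ji; have /implyP/(_ ji)/eqP := pq j.
by apply/implyP => ji; rewrite pq.
Qed.

Lemma same_lineC i p q : same_line i p q = same_line i q p.
Proof. by apply/same_lineP/same_lineP => pq j ji; rewrite pq. Qed.

Lemma same_line_trans i p q t :
  same_line i p q -> same_line i q t = same_line i p t.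
Proof.
move=> /same_lineP pq; apply/same_lineP/same_lineP => h j ji.
  by rewrite pq // h.
by rewrite -pq // h.
Qed.

Lemma same_line_on_line i p s : same_line i (on_line i p s) p.
Proof. by apply/same_lineP => j ji; rewrite ffunE (negPf ji). Qed.

Lemma on_line_same i p q s : same_line i p q -> on_line i p s = on_line i q s.
Proof.
by move=> /same_lineP pq; apply/ffunP => j; rewrite !ffunE; case: eqVneq => // /pq.
Qed.

Lemma on_line_id i p : on_line i p (p i) = p.
Proof. by apply/ffunP => j; rewrite ffunE; case: eqVneq => [->|]. Qed.

Lemma same_line_eq i p q : same_line i p q && (p i == q i) = (p == q).
Proof.
apply/andP/eqP => [[/same_lineP pq /eqP pqi]|->].
  by apply/ffunP => j; case: (eqVneq j i) => [->//|/pq].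
by split=> //; apply/same_lineP.
Qed.

(** [on_line i p] parametrizes the line through [p] bijectively; the inverse reads off coordinate
    [i]. *)
Lemma sum_same_line (V : nmodType) i p (f : grid d N -> V) :
  \sum_(t | same_line i p t) f t = \sum_s f (on_line i p s).
Proof.
rewrite (reindex (on_line i p)) /=; last first.
  exists (fun t => t i) => [s _|t]; first by rewrite ffunE eqxx.
  by rewrite inE => pt; rewrite (on_line_same _ pt) on_line_id.
by apply: eq_bigl => s; rewrite same_lineC same_line_on_line.
Qed.

End Lines.

(* [mxE] would also unfold the Kronecker products down to their entries. *)
Lemma addmxE (V : nmodType) m n (A B : 'M[V]_(m, n)) k l :
  (A + B) k l = A k l + B k l.
Proof. by rewrite mxE. Qed.

Lemma oppmxE (V : zmodType) m n (A : 'M[V]_(m, n)) k l : (- A) k l = - A k l.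
Proof. by rewrite mxE. Qed.

Lemma trmxE (V : Type) m n (A : 'M[V]_(m, n)) k l : A^T k l = A l k.
Proof. by rewrite mxE. Qed.

Section Scheme.
Context (R : realType) (d N : nat) (h1 : R) (ops : 'I_d -> sbp_ops N h1).
Implicit Types (p q : grid d N) (i : 'I_d).

Definition hgrid p : R := \prod_j hx (ops j) 0 (p j).

(** Constant along lines in direction [i], this is both the quadrature weight on the two faces
    normal to [i] and the line weight in [RR]. *)
Definition hface i p : R := \prod_(j | j != i) hx (ops j) 0 (p j).

Lemma hgridE i p : hgrid p = hface i p * hx (ops i) 0 (p i).
Proof. by rewrite /hgrid (bigD1 i) //= mulrC. Qed.

Lemma hgrid_gt0 p : 0 < hgrid p.
Proof. by apply: prodr_gt0 => j _; apply: hx_gt0. Qed.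

Lemma hface_gt0 i p : 0 < hface i p.
Proof. by apply: prodr_gt0 => j _; apply: hx_gt0. Qed.

Lemma hface_same_line i p q : same_line i p q -> hface i p = hface i q.
Proof. by move=> /same_lineP pq; apply: eq_bigr => j ji; rewrite pq. Qed.

Lemma Hx_diag i r : Hx ops i r r = hx (ops i) 0 r.
Proof. by rewrite !mxE eqxx mulr1n. Qed.

Lemma Hgrid_fdiag : Hgrid ops = fdiag hgrid.
Proof.
apply: fmx_ext => p q; rewrite fmxE fdiagE; case: eqP => [<-|/eqP pq].
  by apply: eq_bigr => j _; rewrite Hx_diag.
have [j pqj] : exists j, p j != q j.
  apply/existsP; apply: contraR pq => /existsPn pq.
  by apply/eqP/ffunP => j; have /negbNE/eqP := pq j.
by rewrite (bigD1 j) //= !mxE (negPf pqj) mul0r.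
Qed.

Lemma D1E i p q : D1 ops i (enum_rank p) (enum_rank q) =
  if same_line i p q then Dx (ops i) (p i) (q i) else 0.
Proof.
rewrite fmxE (bigD1 i) //= eqxx; case: ifP => [/same_lineP pq|/negP pq].
  by rewrite big1 ?mulr1 // => j ji; rewrite (negPf ji) mxE pq // eqxx.
have [j ji pqj] : exists2 j, j != i & p j != q j.
  apply/exists_inP; apply: contra_notT pq => /exists_inPn pq.
  by apply/same_lineP => j ji; have /negbNE/eqP := pq j ji.
by rewrite (bigD1 j) //= (negPf ji) mxE (negPf pqj) mul0r mulr0.
Qed.

Lemma D2E i (b : grid d N -> R) p q : D2 ops i b (enum_rank p) (enum_rank q) =
  if same_line i p q
  then Dxx (ops i) (\row_s b (on_line i p s)) (p i) (q i) else 0.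
Proof. exact: fmxE. Qed.

Lemma RRE i (b : grid d N -> R) p q : RR ops i b (enum_rank p) (enum_rank q) =
  if same_line i p q
  then hface i p * Rxx (ops i) (\row_s b (on_line i p s)) (p i) (q i) else 0.
Proof.
rewrite fmxE; case: ifP => // _; congr (_ * _).
by apply: eq_bigr => j _; rewrite Hx_diag.
Qed.

(** The face quadrature of direction [i] as a function on the grid, with the sign of the outward
    normal and zero at points on neither face. *)
Definition bweight i p : R := hface i p * ends R (p i).

Lemma D1_sbp i :
  fdiag hgrid *m D1 ops i = - ((D1 ops i)^T *m fdiag hgrid) + fdiag (bweight i).
Proof.
apply: fmx_ext => p q.
rewrite addmxE oppmxE fdiag_mulr fdiag_mull trmxE !D1E fdiagE.
rewrite [same_line i q p]same_lineC.
rewrite -(same_line_eq i p q).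
case: ifP => [pq|_]; last by rewrite mul0r mulr0 oppr0 addr0.
rewrite (hgridE i) -mulrA Dx_sbpE (hgridE i q) (hface_same_line pq) /bweight /=.
rewrite (hface_same_line pq).
by case: (p i =P q i) => [->|_] /=; ring.
Qed.

(** All terms vanish unless the two points share a line in direction [i]. On such a line the weight
    [hface] factors out and leaves the one-dimensional rule. *)
Lemma D2_sbp i (b : grid d N -> R) :
  fdiag hgrid *m D2 ops i b =
  - ((D1 ops i)^T *m fdiag hgrid *m fdiag b *m D1 ops i) - RR ops i b
  + fdiag (bweight i) *m fdiag b *m D1 ops i.
Proof.
apply: fmx_ext => p q.
rewrite -!mulmxA !addmxE !oppmxE !fdiag_mull D2E RRE D1E [X in - X]mxE.
rewrite sum_enum_rank.
under eq_bigr do rewrite !fdiag_mull trmxE !D1E same_lineC.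
case: ifP => pq; last first.
  rewrite big1 ?mulr0 ?oppr0 ?addr0 // => t _.
  case: ifP => [pt|]; last by rewrite !mul0r.
  by rewrite (same_line_trans _ pt) pq !mulr0.
transitivity (hface i p * (hx (ops i) 0 (p i) *
  Dxx (ops i) (\row_s b (on_line i p s)) (p i) (q i))).
  by rewrite (hgridE i) mulrA.
rewrite Dxx_sbpE !mulrDr !mulrN.
congr (- _ - _ + _); last first.
  by rewrite mxE on_line_id /bweight !mulrA.
(* The intermediate point of the product contributes only if it lies on the line as well, so the sum
   over the grid becomes one over the line. *)
rewrite (bigID (same_line i p)) /= [X in _ = _ + X]big1 ?addr0; last first.
  by move=> t /negPf pt; rewrite pt mul0r.
rewrite sum_same_line mulr_sumr; apply: eq_bigr => s _.
rewrite same_lineC same_line_on_line -(same_line_trans q (same_line_on_line i p s)).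
rewrite pq (hgridE i) (hface_same_line (same_line_on_line i p s)).
by rewrite mxE !ffunE eqxx; ring.
Qed.

Context (F : grid d N -> 'M[R]_d) (hatJ : face d -> grid d N -> R)
        (C : 'I_d -> 'I_d -> 'I_d -> 'I_d -> grid d N -> R)
        (rho : grid d N -> R) (beta : R).
Context (d_gt0 : (0 < d)%N) (N_gt0 : (0 < N)%N).
Context (Jac_gt0 : forall p, 0 < Jac F p)
        (hatJ_gt0 : forall f p, on_face f p -> 0 < hatJ f p)
        (C_sym : forall I J K L p, C I J K L p = C K L I J p)
        (C_psd : forall p (S : 'M[R]_d),
          0 <= \sum_I \sum_J \sum_K \sum_L S I J * C I J K L p * S K L)
        (rho_gt0 : forall p, 0 < rho p) (beta_ge1 : 1 <= beta).
Local Notation cten := (cten F C).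
Local Notation gvec := ('cV[R]_#|grid d N|).

(** Mixed derivatives need only the first-derivative rule for the left factor; the remainder [RR]
    arises only for [i = k]. *)
Lemma DD_sbp i k (b : grid d N -> R) :
  fdiag hgrid *m DD ops i k b =
  - ((D1 ops i)^T *m fdiag (fun p => hgrid p * b p) *m D1 ops k)
  - (if i == k then RR ops i b else 0)
  + fdiag (fun p => bweight i p * b p) *m D1 ops k.
Proof.
rewrite /DD -(fdiagM hgrid b) -(fdiagM (bweight i) b) !mulmxA.
case: eqVneq => [<-|_]; first exact: D2_sbp.
by rewrite subr0 !mulmxA D1_sbp !mulmxDl !mulNmx.
Qed.

(** * Face quadratures, block matrices and Green's formula *)

Definition bface (f : face d) (p : grid d N) : R :=
  if on_face f p then hatJ f p * hface f.1 p else 0.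

(** Extending the face weights by zero turns sums over the points of a face into sums over the whole
    grid, so all faces can be added as matrices of one size. *)
Lemma bface_fdiag f :
  eface R N f *m hatJface hatJ f *m Hface ops f *m (eface R N f)^T =
  fdiag (bface f).
Proof.
have -> : Hface ops f = fdiag (fun p : face_pt N f => hface f.1 (val p)).
  apply: fmx_ext => p q; rewrite fmxE fdiagE; case: eqP => [<-|pq].
    by apply: eq_bigr => j _; rewrite Hx_diag.
  (* Points of one face agree in coordinate [f.1], so distinct ones differ in another coordinate,
     which occurs in the product. *)
  have [j jf pqj] : exists2 j, j != f.1 & val p j != val q j.
    apply/exists_inP; apply: contra_notT pq => /exists_inPn pq.
    apply/val_inj/ffunP => j; have [->|/pq/negbNE/eqP//] := eqVneq j f.1.
    by rewrite (eqP (valP p)) (eqP (valP q)).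
  by rewrite (bigD1 j) //= !mxE (negPf pqj) mul0r.
rewrite -(mulmxA (eface R N f)) /hatJface fdiagM.
apply: fmx_ext => p q; rewrite mxE sum_enum_rank fdiagE /bface.
under eq_bigr do rewrite fdiag_mulr trmxE !fmxE.
case: (boolP (on_face f p)) => fp; last first.
  rewrite if_same big1 // => r _.
  by case: (p =P val r) => [pr|]; rewrite ?mul0r //; move: fp; rewrite pr (valP r).
rewrite (bigD1 (Sub p fp)) //= big1 ?addr0 => [|r /eqP rp].
  by rewrite eqxx mul1r [q == p]eq_sym; case: eqP => _; rewrite ?mulr1 ?mulr0.
case: (p =P val r) => [pr|]; rewrite ?mul0r //.
by case: rp; apply: val_inj.
Qed.

(** Stated with the reference derivatives [D1], as summation by parts produces it; [MvolE] recovers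
    the form with physical gradients. *)
Definition Mvol J L := \sum_i \sum_k
  (D1 ops i)^T *m fdiag (fun p => hgrid p * cten i J k L p) *m D1 ops k.

Definition Mtrac J L := \sum_f fdiag (bface f) *m TT ops F hatJ C f J L.

Definition Mpen J L := \sum_f fdiag (bface f) *m ZZ h1 F hatJ C beta f J L.

Definition Mkin (J L : 'I_d) :=
  if J == L then fdiag (fun p => Jac F p * hgrid p * rho p) else 0.

Lemma cten_sym i J k L p : cten i J k L p = cten k L i J p.
Proof.
rewrite /Defs.cten exchange_big; apply: eq_bigr => K _; apply: eq_bigr => I _.
by rewrite C_sym; ring.
Qed.

Lemma RR_sym i (b : grid d N -> R) : (RR ops i b)^T = RR ops i b.
Proof.
apply: fmx_ext => p q; rewrite trmxE !RRE same_lineC.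
case: ifP => // pq; rewrite (hface_same_line pq) -{1}Rxx_sym trmxE.
by congr (_ * Rxx _ _ _ _); apply/rowP => s; rewrite !mxE (on_line_same _ pq).
Qed.

Lemma tr_Mvol J L : (Mvol L J)^T = Mvol J L.
Proof.
rewrite /Mvol exchange_big linear_sum; apply: eq_bigr => i _ /=.
rewrite linear_sum; apply: eq_bigr => k _ /=.
rewrite !trmx_mul trmxK tr_fdiag mulmxA.
by congr (_ *m _ *m _); apply: eq_fdiag => p; rewrite cten_sym.
Qed.

Lemma tr_WW J L : (WW ops F C L J)^T = WW ops F C J L.
Proof.
rewrite /WW linear_sum; apply: eq_bigr => k _ /=; rewrite RR_sym.
by congr RR; apply/funext => p; rewrite cten_sym.
Qed.

(** Major symmetry of [C] exchanges the pairs [(I, J)] and [(K, L)], and the two normals trade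
    places. *)
Lemma ZZ_sym f J L : ZZ h1 F hatJ C beta f L J = ZZ h1 F hatJ C beta f J L.
Proof.
apply: eq_fdiag => p; rewrite exchange_big /=.
by apply: eq_bigr => I _; apply: eq_bigr => K _; rewrite C_sym; ring.
Qed.

Lemma tr_Mpen J L : (Mpen L J)^T = Mpen J L.
Proof.
rewrite /Mpen linear_sum; apply: eq_bigr => f _ /=.
by rewrite trmx_mul !tr_fdiag fdiagC ZZ_sym.
Qed.

Definition sgface (b : bool) : R := if b then 1 else -1.

Lemma normalE f I p :
  normal F hatJ f I p = (hatJ f p)^-1 * Jac F p * F p I f.1 * sgface f.2.
Proof.
rewrite /normal (bigD1 f.1) //= big1 ?addr0 => [|j /negPf jf].
  by rewrite /nu eqxx.
by rewrite /nu jf mulr0.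
Qed.

(** On the face the scale factor is positive and cancels against the one inside the normal; off the
    face both sides vanish. *)
Lemma bface_normal f I p : bface f p * normal F hatJ f I p =
  (on_face f p)%:R * sgface f.2 * hface f.1 p * (Jac F p * F p I f.1).
Proof.
rewrite normalE /bface; case: ifP => [/hatJ_gt0 h|_]; last by rewrite !mul0r.
have h0 := lt0r_neq0 h; rewrite mul1r.
by field.
Qed.

(** This identifies the boundary traction with the boundary terms of [DD_sbp]: the metric factors of
    the normal and of [DI] combine with [C] into [cten]. *)
Lemma MtracE J L : Mtrac J L = \sum_i \sum_k
  fdiag (fun p => bweight i p * cten i J k L p) *m D1 ops k.
Proof.
rewrite /Mtrac /TT /DI.
transitivity (\sum_k fdiag (fun p => \sum_f \sum_I \sum_K
   bface f p * (normal F hatJ f I p * C I J K L p) * F p K k) *m D1 ops k).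
  under [in RHS]eq_bigr do rewrite -fdiag_sum mulmx_suml.
  rewrite [RHS]exchange_big /=; apply: eq_bigr => f _.
  under [in RHS]eq_bigr do rewrite -fdiag_sum mulmx_suml.
  rewrite [RHS]exchange_big /= mulmx_sumr; apply: eq_bigr => I _.
  under [in RHS]eq_bigr do rewrite -fdiag_sum mulmx_suml.
  rewrite [RHS]exchange_big /= mulmx_sumr; apply: eq_bigr => K _.
  rewrite mulmx_sumr mulmx_sumr; apply: eq_bigr => k _.
  by rewrite !mulmxA !fdiagM.
rewrite [RHS]exchange_big /=; apply: eq_bigr => k _.
rewrite -mulmx_suml fdiag_sum; congr (_ *m _); apply: eq_fdiag => p.
(* A face is a direction and a side; the opposite signs of the two sides are collected by [ends]. *)
transitivity (\sum_i \sum_b \sum_I \sum_K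
  bface (i, b) p * (normal F hatJ (i, b) I p * C I J K L p) * F p K k).
  by rewrite [RHS]pair_bigA; apply: eq_bigr => -[].
apply: eq_bigr => i _.
have E b : \sum_I \sum_K bface (i, b) p * (normal F hatJ (i, b) I p * C I J K L p)
    * F p K k = (on_face (i, b) p)%:R * sgface b * hface i p * cten i J k L p.
  rewrite /Defs.cten mulr_sumr; apply: eq_bigr => I _.
  rewrite mulr_sumr; apply: eq_bigr => K _; rewrite mulrA bface_normal /=; ring.
by rewrite big_bool /= !E /bweight /ends /on_face /=; ring.
Qed.

(** The discrete Green's formula, obtained by summing [DD_sbp] over [i] and [k]; only the terms with
    [k = i] contribute to [WW]. *)
Lemma JacH_DOmega J L :
  fdiag (Jac F) *m Hgrid ops *m DOmega ops F C J L =
  Mtrac J L - Mvol J L - WW ops F C J L.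
Proof.
rewrite Hgrid_fdiag fdiagC -mulmxA /DOmega (mulmxA (fdiag (Jac F))) fdiagM.
have -> : fdiag (fun p => Jac F p * (Jac F p)^-1) = 1%:M.
  by rewrite -fdiag1; apply: eq_fdiag => p; rewrite divff // gt_eqF.
rewrite mul1mx mulmx_sumr MtracE /Mvol /WW -!sumrB; apply: eq_bigr => i _.
rewrite mulmx_sumr; under eq_bigr do rewrite DD_sbp.
rewrite !big_split /= addrC -addrA sumrN; congr (_ + _).
congr (_ + _); rewrite sumrN; congr (- _).
rewrite (bigD1 i) //= eqxx big1 ?addr0 // => k ki.
by rewrite eq_sym (negPf ki).
Qed.

(** * Conservation of the energy *)

Lemma ip_bndE (u w : gvec) (X : face d -> 'M[R]_#|grid d N|) :
  ip_bnd ops hatJ (fun _ => u) (fun f => X f *m w) =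
  (u^T *m (\sum_f fdiag (bface f) *m X f) *m w) 0 0.
Proof.
rewrite mulmx_sumr mulmx_suml summxE; apply: eq_bigr => f _.
by rewrite -bface_fdiag trmx_mul trmxK !mulmxA.
Qed.

Lemma ip_volE (u w : gvec) : ip_vol ops F u w =
  (u^T *m fdiag (fun p => Jac F p * hgrid p) *m w) 0 0.
Proof. by rewrite /ip_vol Hgrid_fdiag -[u^T *m _ *m _]mulmxA fdiagM. Qed.

(** The discrete chain rule in [DI] moves the metric factors of [cten] onto the derivatives. *)
Lemma MvolE J L : Mvol J L = \sum_I \sum_K
  (DI ops F I)^T *m fdiag (fun p => Jac F p * hgrid p * C I J K L p) *m DI ops F K.
Proof.
transitivity (\sum_i \sum_k \sum_I \sum_K (D1 ops i)^T *m fdiag (fun p =>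
    F p I i * (Jac F p * hgrid p * C I J K L p) * F p K k) *m D1 ops k).
  apply: eq_bigr => i _; apply: eq_bigr => k _.
  under [RHS]eq_bigr do rewrite -mulmx_suml -mulmx_sumr fdiag_sum.
  rewrite -mulmx_suml -mulmx_sumr fdiag_sum; congr (_ *m _ *m _).
  apply: eq_fdiag => p; rewrite mulr_sumr; apply: eq_bigr => I _.
  by rewrite mulr_sumr; apply: eq_bigr => K _; ring.
under eq_bigr do rewrite exchange_big /=.
rewrite exchange_big /=; apply: eq_bigr => I _.
under eq_bigr do rewrite exchange_big /=.
rewrite exchange_big /=; apply: eq_bigr => K _.
rewrite /DI (linear_sum trmx) !mulmx_suml; apply: eq_bigr => i _.
rewrite mulmx_sumr; apply: eq_bigr => k _ /=.
by rewrite trmx_mul tr_fdiag -!fdiagM !mulmxA.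
Qed.

Lemma ip_vol_elastic (u : 'I_d -> gvec) :
  \sum_I \sum_J \sum_K \sum_L
      ip_vol ops F (DI ops F I *m u J) (fdiag (C I J K L) *m (DI ops F K *m u L)) =
  bform Mvol u u.
Proof.
rewrite exchange_big; apply: eq_bigr => J _ /=.
under eq_bigr do rewrite exchange_big.
rewrite exchange_big; apply: eq_bigr => L _ /=.
rewrite MvolE mulmx_sumr mulmx_suml summxE; apply: eq_bigr => I _.
rewrite mulmx_sumr mulmx_suml summxE; apply: eq_bigr => K _.
by rewrite ip_volE trmx_mul -[in RHS]fdiagM !mulmxA.
Qed.

Lemma ip_vol_kinetic (v : 'I_d -> gvec) :
  \sum_J ip_vol ops F (v J) (fdiag rho *m v J) = bform Mkin v v.
Proof.
apply: eq_bigr => J _.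
rewrite (bigD1 J) //= big1 ?addr0 => [|L /negPf LJ].
  by rewrite ip_volE /Mkin eqxx mulmxA -[X in X *m _]mulmxA fdiagM.
by rewrite /Mkin eq_sym LJ mulmx0 mul0mx mxE.
Qed.

Lemma energyE u v : energy ops F hatJ C rho beta u v =
  2^-1 * bform Mkin v v + 2^-1 * bform Mvol u u
  + 2^-1 * bform (WW ops F C) u u - bform Mtrac u u + 2^-1 * bform Mpen u u.
Proof.
rewrite /energy ip_vol_kinetic ip_vol_elastic; congr (_ - _ + 2^-1 * _);
by apply: eq_bigr => J _; apply: eq_bigr => L _; rewrite ip_bndE.
Qed.

Lemma JacH_rhs u J :
  fdiag (Jac F) *m Hgrid ops *m rhs ops F hatJ C beta (fun _ _ => 0) u J =
  \sum_L (Mtrac J L - Mvol J L - WW ops F C J L + (Mtrac L J)^T - Mpen J L) *m u L.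
Proof.
have JH_unit : fdiag (Jac F) *m Hgrid ops \in unitmx.
  rewrite Hgrid_fdiag fdiagM fdiag_unit // => p.
  by rewrite mulf_neq0 // gt_eqF // hgrid_gt0.
rewrite /rhs mulmxDr mulKVmx // mulmx_sumr exchange_big -big_split /=.
apply: eq_bigr => L _.
rewrite mulmxA JacH_DOmega -[_ + _^T - _]addrA [RHS]mulmxDl; congr (_ + _).
(* The scheme transposes traction and penalty together, so the symmetric [Mpen] is first written as
   a transpose. *)
rewrite /Mtrac (linear_sum trmx) -[Mpen _ _]tr_Mpen (linear_sum trmx) -sumrB mulmx_suml.
apply: eq_bigr => f _ /=.
rewrite !trmx_mul -mulmxBl -linearB subr0 tr_fdiag -bface_fdiag /=.
by rewrite !mulmxA.
Qed.

(** The weighted scheme is tested with [v]. The traction appears once from Green's formula and once,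
    with exchanged arguments, from the transposed boundary term. *)
Lemma power_balance u v a :
  (forall J, fdiag rho *m a J = rhs ops F hatJ C beta (fun _ _ => 0) u J) ->
  bform Mkin v a = bform Mtrac v u + bform Mtrac u v - bform Mvol v u
    - bform (WW ops F C) v u - bform Mpen v u.
Proof.
move=> rhoa.
transitivity (bform (fun J L => Mtrac J L - Mvol J L - WW ops F C J L
    + (Mtrac L J)^T - Mpen J L) v u).
  apply: eq_bigr => J _; rewrite (bigD1 J) //= big1 ?addr0 => [|L /negPf LJ].
    rewrite -[in RHS]summxE; under [in RHS]eq_bigr do rewrite -mulmxA.
    rewrite -mulmx_sumr -JacH_rhs -rhoa Hgrid_fdiag /Mkin eqxx.
    by rewrite !mulmxA -[in RHS](mulmxA (v J)^T) fdiagM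
      -[in RHS](mulmxA (v J)^T) fdiagM.
  by rewrite /Mkin eq_sym LJ mulmx0 mul0mx mxE.
rewrite !bformD !bformN bformC; ring.
Qed.

(** For a symmetric block the factor 1/2 absorbs the two equal terms of the product rule. [Mtrac]
    need not be symmetric, but it enters the energy with factor 1, and its two terms are exactly
    those of [power_balance]. *)
Lemma energy_conserved (U : set R) (u v : R -> 'I_d -> gvec) (t : R) :
  scheme_solution ops F hatJ C rho beta U (fun _ _ _ => 0) u v -> U t ->
  is_derive t 1 (fun s => energy ops F hatJ C rho beta (u s) (v s)) 0.
Proof.
move=> [du [a [dv scheme]]] Ut.
have duu M := is_derive_bform M (du t Ut) (du t Ut).
have dvv M := is_derive_bform M (dv t Ut) (dv t Ut).
under eq_fun do rewrite energyE.
apply: (@is_derive_eq _ _ _ _ _ _ _ _ (is_deriveD (is_deriveB (is_deriveD (is_deriveD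
  (is_deriveZ 2^-1 (dvv Mkin)) (is_deriveZ 2^-1 (duu Mvol)))
  (is_deriveZ 2^-1 (duu (WW ops F C)))) (duu Mtrac)) (is_deriveZ 2^-1 (duu Mpen)))).
have Mkin_sym J L : (Mkin L J)^T = Mkin J L.
  by rewrite /Mkin eq_sym; case: ifP => _; rewrite ?tr_fdiag ?trmx0.
rewrite (bform_sym (a t) (v t) Mkin_sym).
rewrite (bform_sym (u t) (v t) tr_Mvol).
rewrite (bform_sym (u t) (v t) tr_WW).
rewrite (bform_sym (u t) (v t) tr_Mpen).
rewrite (power_balance (v t) (scheme t Ut)).
rewrite /GRing.scale /=; lra.
Qed.

(** * Nonnegativity of the energy *)

(* Averaging over the points of each line replaces a choice of representatives
   of the lines. *)
Lemma sum_lines (V : nmodType) (i : 'I_d) (f : grid d N -> V) :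
  \sum_p \sum_s f (on_line i p s) = (\sum_p f p) *+ N.+1.
Proof.
under eq_bigr do rewrite -sum_same_line.
rewrite (exchange_big_dep xpredT) //= -sumrMnl; apply: eq_bigr => t _.
under eq_bigl do rewrite same_lineC.
by rewrite sum_same_line sumr_const card_ord.
Qed.

(** [RR] couples only points of a common line, so its form is a sum of one-dimensional forms.
    Summing over all [p] counts each line once per point, hence the multiplicity [N.+1]. *)
Lemma RR_form_lines (i : 'I_d) (b : 'I_d -> 'I_d -> grid d N -> R) (u : 'I_d -> gvec) :
  bform (fun J L => RR ops i (b J L)) u u *+ N.+1 = \sum_p hface i p *
    bform (fun J L => Rxx (ops i) (\row_s b J L (on_line i p s)))
      (fun J => \col_s u J (enum_rank (on_line i p s)) 0)
      (fun J => \col_s u J (enum_rank (on_line i p s)) 0).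
Proof.
(* [f p] is the contribution of row [p]; its sum over a line assembles the one-dimensional form of
   that line. *)
pose f (p : grid d N) := \sum_J \sum_L \sum_s u J (enum_rank p) 0 * hface i p *
  Rxx (ops i) (\row_s b J L (on_line i p s)) (p i) s *
  u L (enum_rank (on_line i p s)) 0.
have -> : bform (fun J L => RR ops i (b J L)) u u = \sum_p f p.
  rewrite exchange_big; apply: eq_bigr => J _ /=.
  rewrite exchange_big; apply: eq_bigr => L _ /=.
  rewrite -mulmxA mxE sum_enum_rank; apply: eq_bigr => p _.
  rewrite trmxE mxE sum_enum_rank (bigID (same_line i p)) /=.
  rewrite [X in _ + X]big1 ?addr0 => [|q /negPf pq]; last by rewrite RRE pq mul0r.
  rewrite sum_same_line mulr_sumr; apply: eq_bigr => s _.
  by rewrite RRE same_lineC same_line_on_line !ffunE eqxx; ring.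
rewrite -(sum_lines i); apply: eq_bigr => p _.
rewrite exchange_big mulr_sumr; apply: eq_bigr => J _ /=.
rewrite exchange_big mulr_sumr; apply: eq_bigr => L _ /=.
rewrite -mulmxA mxE mulr_sumr; apply: eq_bigr => r _.
rewrite trmxE !mxE !mulr_sumr; apply: eq_bigr => s _; rewrite mxE.
have onon t : on_line i (on_line i p r) t = on_line i p t.
  exact/on_line_same/same_line_on_line.
rewrite onon (hface_same_line (same_line_on_line i p r)) ffunE eqxx.
rewrite (_ : (\row_s0 b J L (on_line i (on_line i p r) s0)) =
  \row_s0 b J L (on_line i p s0)); last by apply/rowP => t; rewrite !mxE onon.
by ring.
Qed.

(** * The elastic form at a grid point and the energy terms as pointwise sums *)

Definition Cform p (S T : 'M[R]_d) : R :=
  \sum_I \sum_J \sum_K \sum_L S I J * C I J K L p * T K L.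

Lemma CformC p S T : Cform p S T = Cform p T S.
Proof.
rewrite /Cform; under eq_bigr do rewrite exchange_big /=.
rewrite exchange_big /=; apply: eq_bigr => K _.
under eq_bigr do rewrite exchange_big /=.
rewrite exchange_big /=; apply: eq_bigr => L _.
apply: eq_bigr => I _; apply: eq_bigr => J _.
by rewrite C_sym; ring.
Qed.

(** Semidefiniteness of [C] is applied to the rank-one tensor formed from column [k] of the metric
    and [x]. *)
Lemma cten_psd k (x : 'I_d -> R) p : 0 <= \sum_J \sum_L x J * cten k J k L p * x L.
Proof.
pose S : 'M[R]_d := \matrix_(I, J) (F p I k * x J).
have SE I J : S I J = F p I k * x J by rewrite mxE.
rewrite (_ : \sum_J _ = Jac F p * Cform p S S).
  by rewrite mulr_ge0 ?C_psd // ltW.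
rewrite /Cform [in RHS]exchange_big mulr_sumr; apply: eq_bigr => J _ /=.
under [in RHS]eq_bigr do rewrite exchange_big /=.
rewrite [in RHS]exchange_big mulr_sumr; apply: eq_bigr => L _ /=.
rewrite /Defs.cten [RHS]mulr_sumr mulr_sumr mulr_suml; apply: eq_bigr => I _.
rewrite [RHS]mulr_sumr mulr_sumr mulr_suml; apply: eq_bigr => K _.
by rewrite !SE; ring.
Qed.

Lemma WW_psd (u : 'I_d -> gvec) : 0 <= bform (WW ops F C) u u.
Proof.
rewrite (_ : bform _ u u = \sum_k bform (fun J L => RR ops k (cten k J k L)) u u).
  apply: sumr_ge0 => k _; rewrite -(pmulrn_lge0 _ (ltn0Sn N)) RR_form_lines.
  apply: sumr_ge0 => p _; rewrite mulr_ge0 ?(ltW (hface_gt0 _ _)) //.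
  apply: Rxx_psd => s x; under eq_bigr do under eq_bigr do rewrite mxE.
  exact: cten_psd.
rewrite /bform [RHS]exchange_big; apply: eq_bigr => J _ /=.
rewrite [RHS]exchange_big; apply: eq_bigr => L _ /=.
by rewrite /WW mulmx_sumr mulmx_suml summxE.
Qed.

Lemma CformDl p S S' T : Cform p (S + S') T = Cform p S T + Cform p S' T.
Proof.
rewrite /Cform -big_split; apply: eq_bigr => I _ /=.
rewrite -big_split; apply: eq_bigr => J _ /=.
rewrite -big_split; apply: eq_bigr => K _ /=.
rewrite -big_split; apply: eq_bigr => L _ /=.
by rewrite mxE; ring.
Qed.

Lemma CformZl p a S T : Cform p (a *: S) T = a * Cform p S T.
Proof.
rewrite /Cform mulr_sumr; apply: eq_bigr => I _.
rewrite mulr_sumr; apply: eq_bigr => J _.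
rewrite mulr_sumr; apply: eq_bigr => K _.
rewrite mulr_sumr; apply: eq_bigr => L _.
by rewrite mxE; ring.
Qed.

Lemma Cform_complete_square p (a : R) (S G : 'M[R]_d) :
  Cform p (G + a *: S) (G + a *: S) =
  Cform p G G + 2 * a * Cform p S G + a ^+ 2 * Cform p S S.
Proof.
rewrite CformDl CformZl [Cform p G _]CformC [Cform p S (_ + _)]CformC.
by rewrite !CformDl !CformZl [Cform p G S]CformC; ring.
Qed.

Definition grad (u : 'I_d -> gvec) (p : grid d N) : 'M[R]_d :=
  \matrix_(I, J) (DI ops F I *m u J) (enum_rank p) 0.

Definition normal_disp f (u : 'I_d -> gvec) (p : grid d N) : 'M[R]_d :=
  \matrix_(I, J) (normal F hatJ f I p * u J (enum_rank p) 0).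

Lemma Mvol_form u : bform Mvol u u =
  \sum_p Jac F p * hgrid p * Cform p (grad u p) (grad u p).
Proof.
rewrite -ip_vol_elastic /Cform.
under [RHS]eq_bigr do rewrite mulr_sumr.
rewrite [RHS]exchange_big; apply: eq_bigr => I _ /=.
under [RHS]eq_bigr do rewrite mulr_sumr.
rewrite [RHS]exchange_big; apply: eq_bigr => J _ /=.
under [RHS]eq_bigr do rewrite mulr_sumr.
rewrite [RHS]exchange_big; apply: eq_bigr => K _ /=.
under [RHS]eq_bigr do rewrite mulr_sumr.
rewrite [RHS]exchange_big; apply: eq_bigr => L _ /=.
rewrite ip_volE dot_fdiag; apply: eq_bigr => p _.
have gE A B : grad u p A B = (DI ops F A *m u B) (enum_rank p) 0 by rewrite mxE.
by rewrite !gE fdiag_mull; ring.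
Qed.

Lemma face_form (X : face d -> 'I_d -> 'I_d -> 'M[R]_#|grid d N|) u :
  bform (fun J L => \sum_f fdiag (bface f) *m X f J L) u u =
  \sum_f \sum_p bface f p * \sum_J \sum_L
    u J (enum_rank p) 0 * (X f J L *m u L) (enum_rank p) 0.
Proof.
transitivity (\sum_J \sum_L \sum_f \sum_p bface f p *
  (u J (enum_rank p) 0 * (X f J L *m u L) (enum_rank p) 0)).
  apply: eq_bigr => J _; apply: eq_bigr => L _.
  rewrite mulmx_sumr mulmx_suml summxE; apply: eq_bigr => f _.
  rewrite -mulmxA -(mulmxA (fdiag _)) mulmxA dot_fdiag; apply: eq_bigr => p _.
  by rewrite mulrA.
under eq_bigr do rewrite exchange_big /=.
rewrite exchange_big; apply: eq_bigr => f _ /=.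
under eq_bigr do rewrite exchange_big /=.
rewrite exchange_big; apply: eq_bigr => p _ /=.
by rewrite mulr_sumr; apply: eq_bigr => J _; rewrite mulr_sumr.
Qed.

Lemma Mtrac_form u : bform Mtrac u u =
  \sum_f \sum_p bface f p * Cform p (normal_disp f u p) (grad u p).
Proof.
rewrite face_form; apply: eq_bigr => f _; apply: eq_bigr => p _; congr (_ * _).
have gE A B : grad u p A B = (DI ops F A *m u B) (enum_rank p) 0 by rewrite mxE.
have nE A B : normal_disp f u p A B =
  normal F hatJ f A p * u B (enum_rank p) 0 by rewrite mxE.
rewrite /Cform [RHS]exchange_big; apply: eq_bigr => J _ /=.
under [RHS]eq_bigr do rewrite exchange_big /=.
rewrite [RHS]exchange_big; apply: eq_bigr => L _ /=.
rewrite /TT mulmx_suml summxE mulr_sumr; apply: eq_bigr => I _.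
rewrite mulmx_suml summxE mulr_sumr; apply: eq_bigr => K _.
by rewrite gE nE -mulmxA fdiag_mull; ring.
Qed.

Lemma Mpen_form u : bform Mpen u u =
  \sum_f \sum_p bface f p * (beta * (d%:R * hatJ f p / (h1 * Jac F p))) *
    Cform p (normal_disp f u p) (normal_disp f u p).
Proof.
rewrite face_form; apply: eq_bigr => f _; apply: eq_bigr => p _.
rewrite -mulrA; congr (_ * _).
have nE A B : normal_disp f u p A B =
  normal F hatJ f A p * u B (enum_rank p) 0 by rewrite mxE.
rewrite /Cform [in RHS]exchange_big mulr_sumr; apply: eq_bigr => J _ /=.
under [in RHS]eq_bigr do rewrite exchange_big /=.
rewrite [in RHS]exchange_big mulr_sumr; apply: eq_bigr => L _ /=.
rewrite /ZZ fdiag_mull mulr_suml [LHS]mulr_sumr [RHS]mulr_sumr.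
apply: eq_bigr => I _.
rewrite mulr_suml [LHS]mulr_sumr [RHS]mulr_sumr; apply: eq_bigr => K _.
by rewrite !nE; ring.
Qed.

Lemma h1_gt0 : 0 < h1.
Proof. by rewrite -(hx_first (ops (Ordinal d_gt0))) hx_gt0. Qed.

(** The weight in the normal direction is [h1] at the first point by definition and at the last one
    by the reflection symmetry [hx_rev]. *)
Lemma hgrid_on_face f p : on_face f p -> hgrid p = hface f.1 p * h1.
Proof.
rewrite (hgridE f.1) => /eqP ->; congr (_ * _).
case: f.2; last exact: hx_first.
rewrite -[RHS](hx_first (ops f.1)) -[RHS]hx_rev; congr (hx _ _ _).
by apply: val_inj; rewrite /= subn1.
Qed.

(** In each direction a point lies on at most one of two opposite faces, because [0 < N] keeps the
    end points distinct. *)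
Lemma sum_on_face (p : grid d N) : \sum_(f | on_face f p) 1 <= d%:R :> R.
Proof.
rewrite big_mkcond /=.
have -> : \sum_(f : face d) (if on_face f p then 1 else 0 : R) =
    \sum_(i < d) \sum_b if on_face (i, b) p then 1 else 0.
  by rewrite [RHS]pair_bigA; apply: eq_bigr => -[].
apply: (@le_trans _ _ (\sum_(i < d) 1)); last by rewrite sumr_const card_ord.
apply: ler_sum => i _; rewrite big_bool /on_face /=.
case: eqVneq => [->|_]; last by case: ifP; rewrite add0r.
by rewrite -val_eqE /= eqn0Ngt N_gt0 addr0.
Qed.

Lemma energy_ge0 u v : 0 <= energy ops F hatJ C rho beta u v.
Proof.
have kin_ge0 : 0 <= bform Mkin v v.
  rewrite -ip_vol_kinetic; apply: sumr_ge0 => J _.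
  rewrite ip_volE dot_fdiag; apply: sumr_ge0 => p _; rewrite fdiag_mull.
  rewrite (_ : _ * _ = Jac F p * hgrid p * rho p * v J (enum_rank p) 0 ^+ 2).
    by rewrite mulr_ge0 ?sqr_ge0 // ltW // !mulr_gt0 ?hgrid_gt0.
  by ring.
have el_ge0 p : 0 <= Cform p (grad u p) (grad u p) by exact: C_psd.
have d0 : 0 < d%:R :> R by rewrite ltr0n.
(* The share 1/d of the volume weight at [p], available to each face through [p]. *)
pose m p : R := Jac F p * hgrid p / d%:R.
have m_gt0 p : 0 < m p by rewrite divr_gt0 ?mulr_gt0 ?hgrid_gt0.
have vol_split : \sum_f \sum_(p | on_face f p) m p * Cform p (grad u p) (grad u p)
    <= bform Mvol u u.
  rewrite Mvol_form (exchange_big_dep xpredT) //=; apply: ler_sum => p _.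
  under eq_bigr do rewrite -[m p * _]mul1r.
  rewrite -mulr_suml mulrA ler_wpM2r // -ler_pdivlMr //.
  apply: le_trans (sum_on_face p) _.
  by rewrite /m invf_div mulrCA divff ?mulr1 // gt_eqF // mulr_gt0 ?hgrid_gt0.
(* Kinetic energy and [WW] are dropped as nonnegative, and the rest is doubled. *)
suff : 0 <= \sum_f \sum_(p | on_face f p) m p * Cform p (grad u p) (grad u p)
    - 2 * bform Mtrac u u + bform Mpen u u.
  by have := WW_psd u; rewrite energyE; lra.
rewrite Mtrac_form Mpen_form mulr_sumr -sumrB -big_split /=.
apply: sumr_ge0 => f _.
rewrite big_mkcond mulr_sumr -sumrB -big_split /=.
apply: sumr_ge0 => p _; rewrite /bface; case: ifP => [fp|_]; last first.
  by rewrite !mul0r mulr0 subr0 addr0.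
(* With this [x] the face weight is [m p * x] and the penalty coefficient is [beta * x], so the face
   terms complete to a square with excess [(beta - 1) * x ^+ 2]. *)
pose x := d%:R * hatJ f p / (h1 * Jac F p).
have mx : hatJ f p * hface f.1 p = m p * x.
  rewrite /m /x (hgrid_on_face fp).
  have h10 := lt0r_neq0 h1_gt0; have d00 := lt0r_neq0 d0.
  have J0 := lt0r_neq0 (Jac_gt0 p).
  by field; rewrite h10 d00 J0.
rewrite mx -/x.
move: (normal_disp f u p) (grad u p) => S G.
have SS0 : 0 <= Cform p S S by exact: C_psd.
have QQ0 : 0 <= Cform p (G + - x *: S) (G + - x *: S) by exact: C_psd.
rewrite (_ : _ + _ = m p * (Cform p (G + - x *: S) (G + - x *: S) +
    (beta - 1) * x ^+ 2 * Cform p S S)); last first.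
  by rewrite Cform_complete_square; ring.
rewrite mulr_ge0 ?(ltW (m_gt0 _)) // addr_ge0 //.
by rewrite mulr_ge0 // mulr_ge0 ?sqr_ge0 ?subr_ge0.
Qed.

End Scheme.

Unset Implicit Arguments.

Theorem theorem2 (R : realType) (d N : nat) (h1 : R)
    (ops : 'I_d -> sbp_ops N h1)
    (F : grid d N -> 'M[R]_d)
    (hatJ : face d -> grid d N -> R)
    (C : 'I_d -> 'I_d -> 'I_d -> 'I_d -> grid d N -> R)
    (rho : grid d N -> R) (beta : R)
    (d_gt0 : (0 < d)%N) (N_gt0 : (0 < N)%N)
    (F_unit : forall p, F p \in unitmx)
    (Jac_gt0 : forall p, 0 < Jac F p)
    (hatJ_gt0 : forall f p, on_face f p -> 0 < hatJ f p)
    (C_sym : forall I J K L p, C I J K L p = C K L I J p)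
    (C_psd : forall p (S : 'M[R]_d),
      0 <= \sum_I \sum_J \sum_K \sum_L S I J * C I J K L p * S K L)
    (rho_gt0 : forall p, 0 < rho p)
    (beta_ge1 : 1 <= beta) :
  (forall (U : set R) (u v : R -> 'I_d -> 'cV[R]_#|grid d N|),
     open U ->
     scheme_solution ops F hatJ C rho beta U (fun _ _ _ => 0) u v ->
     forall t, U t ->
       is_derive t 1 (fun s => energy ops F hatJ C rho beta (u s) (v s)) 0) /\
  (forall u v : 'I_d -> 'cV[R]_#|grid d N|,
     0 <= energy ops F hatJ C rho beta u v).
Proof.
split=> [U u v _ sol t Ut|u v].
  exact: (energy_conserved Jac_gt0 hatJ_gt0 C_sym sol Ut).
exact: energy_ge0.
Qed.
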